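(* Let $n\ge 1$ and let $\Delta=(\Delta_{ij})$ be an integer $n\times n$ matrix such that $\det\Delta\neq 0$, $\Delta_{ij}\le 0$ for all $i\ne j$, and there exists a vector $\mathbf r\in\mathbb Z^n$ with $\mathbf r>0$ and $\mathbf r\Delta\ge 0$. Let $\mathbf d=(\Delta_{11}-1,\Delta_{22}-1,\dots,\Delta_{nn}-1)$. For any $\mathbf r\in\mathscr R(\Delta)$, a configuration $\mathbf u$ is a $(\Delta,\mathbf r)$-recurrent configuration if and only if $\mathbf d-\mathbf u$ is a $(\Delta,\mathbf r)$-parking function.
   Context: Vectors are row vectors. $\mathbf r>0$ means $r_i>0$ for all $i$; $\mathbf r\ge \mathbf r'$ means $r_i\ge r'_i$ for all $i$. $\mathscr R(\Delta)=\{\mathbf r\in\mathbb Z^n : \mathbf r>0,\ \mathbf r\Delta\ge 0\}$. For $\mathbf r\in\mathscr R(\Delta)$, $\Omega(\mathbf r)$ is the set of integer vectors $\chi=(\chi(1),\dots,\chi(n))$ with $0\le\chi(i)\le r_i$ for every $i$ and $\chi(i)\ne 0$ for some $i$. $\Delta^j$ is the $j$-th column of $\Delta$, $\Delta_i$ is the $i$-th row of $\Delta$, and $\langle X,Y\rangle=\sum_{i=1}^n X_iY_i$. A $(\Delta,\mathbf r)$-parking function is a function $f:\{1,\dots,n\}\to\{0,1,2,\dots\}$ such that for every $\chi\in\Omega(\mathbf r)$ there exists $j$ with $\chi(j)\ge 1$ and $0\le f(j)<\langle\chi,\Delta^j\rangle$. A function $f$ on $\{1,\dots,n\}$ is identified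 with the vector $(f(1),\dots,f(n))$. A configuration is a row vector $\mathbf u\in\mathbb Z^n$ with $u_i\ge 0$ for all $i$. A vertex $i\in\{1,\dots,n\}$ is critical for $\mathbf u$ if $u_i\ge\Delta_{ii}$; $\mathbf u$ is stable if no vertex is critical, i.e. $0\le u_i<\Delta_{ii}$ for all $i$. Toppling a critical vertex $i$ replaces $\mathbf u$ by $\mathbf u-\Delta_i$. A sequence of topplings from $\mathbf u$ is a sequence $i_1,\dots,i_k$ such that $i_j$ is critical for $\mathbf u-\Delta_{i_1}-\cdots-\Delta_{i_{j-1}}$ for each $1\le j\le k$; it transforms $\mathbf u$ into $\mathbf u-\sum_{j=1}^k\Delta_{i_j}$. A $(\Delta,\mathbf r)$-recurrent configuration is a stable configuration $\mathbf u$ such that $\mathbf u+\mathbf r\Delta$ can be transformed into $\mathbf u$ by a sequence of topplings. *)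

(* Defs.v *)
From mathcomp Require Import all_boot all_order all_algebra.

Set Implicit Arguments.
Unset Strict Implicit.
Unset Printing Implicit Defensive.

Import Order.TTheory GRing.Theory Num.Theory.
Local Open Scope ring_scope.

Section Definitions.
Variable n : nat.
Implicit Types (Delta : 'M[int]_n) (r u v w chi f X Y : 'rV[int]_n) (i j : 'I_n).

Definition vpos r : Prop := forall i, 0 < r 0 i.

Definition vge u v : Prop := forall i, v 0 i <= u 0 i.

Definition inner X Y : int := \sum_(i < n) X 0 i * Y 0 i.

Definition scriptR Delta r : Prop := vpos r /\ vge (r *m Delta) 0.

Definition Omega r chi : Prop :=
  (forall i, 0 <= chi 0 i <= r 0 i) /\ (exists i, chi 0 i != 0).

(* Functions {1..n} -> {0,1,2,...} are encoded as nonnegative integer row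
   vectors, so that [d - u] below needs no truncated subtraction. *)
Definition parking Delta r f : Prop :=
  (forall i, 0 <= f 0 i) /\
  (forall chi, Omega r chi ->
     exists j, 1 <= chi 0 j /\ 0 <= f 0 j < inner chi (col j Delta)^T).

Definition configuration u : Prop := forall i, 0 <= u 0 i.

Definition critical Delta u i : Prop := Delta i i <= u 0 i.

Definition stable Delta u : Prop :=
  configuration u /\ (forall i, ~ critical Delta u i).

Definition topple Delta u i : 'rV[int]_n := u - row i Delta.

Fixpoint topplings Delta u (s : seq 'I_n) : Prop :=
  if s is i :: s' then critical Delta u i /\ topplings Delta (topple Delta u i) s'
  else True.

Definition transforms Delta u v : Prop :=
  exists s : seq 'I_n,
    topplings Delta u s /\ v = u - \sum_(i <- s) row i Delta.

Definition recurrent Delta r u : Prop :=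
  stable Delta u /\ transforms Delta (u + r *m Delta) u.

Definition dvec Delta : 'rV[int]_n := \row_i (Delta i i - 1).

End Definitions.

(* Main.v *)
(** A toppling sequence from [u + r Delta] to [u] topples each vertex [i] exactly
    [r_i] times, because [Delta] is nonsingular; after some topplings the current
    configuration is [u + chi Delta] with [chi] the vector of remaining topplings.
    Vertex [j] is critical for [u + chi Delta] iff
    [(d - u)_j < <chi, Delta^j>].  Hence the parking condition says that one can
    always topple a vertex of the support of [chi], for every nonzero [chi <= r].
    Conversely, given a sequence and [chi], the first toppling after which the
    remaining vector no longer dominates [chi] provides the vertex [j]. *)

Require Import Defs.
From mathcomp Require Import all_boot all_order all_algebra.
From mathcomp Require Import zify.
Import Order.TTheory GRing.Theory Num.Theory.
Local Open Scope ring_scope.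

Definition score {n : nat} (s : seq 'I_n) : 'rV[int]_n :=
  \sum_(i <- s) delta_mx 0 i.

Lemma score_cons n (i : 'I_n) (s : seq 'I_n) k :
  score (i :: s) 0 k = (k == i)%:R + score s 0 k.
Proof. by rewrite /score big_cons !mxE eqxx. Qed.

Lemma score_ge0 n (s : seq 'I_n) k : 0 <= score s 0 k.
Proof. by rewrite /score summxE sumr_ge0 // => i _; rewrite mxE ler0n. Qed.

Lemma sum_rows_score n (Delta : 'M[int]_n) (s : seq 'I_n) :
  \sum_(i <- s) row i Delta = score s *m Delta.
Proof. by rewrite mulmx_suml; apply: eq_bigr => i _; rewrite rowE. Qed.

(** Over the integers [Delta] need not be invertible; multiplying by the adjugate leaves the scalar
    [\det Delta], which cancels. *)
Lemma mulmx_det_inj n (Delta : 'M[int]_n) (v w : 'rV[int]_n) :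
  \det Delta != 0 -> v *m Delta = w *m Delta -> v = w.
Proof.
move=> hdet /(congr1 (mulmx^~ (\adj Delta))).
rewrite -!mulmxA mul_mx_adj !mul_mx_scalar => e; apply/rowP => i.
by move/rowP/(_ i): e; rewrite !mxE; apply: mulfI.
Qed.

Lemma inner_col n (Delta : 'M[int]_n) (chi : 'rV[int]_n) j :
  inner chi (col j Delta)^T = (chi *m Delta) 0 j.
Proof. by rewrite /inner mxE; apply: eq_bigr => k _; rewrite !mxE. Qed.

(** The [- 1] in [dvec] turns the strict parking inequality into the weak one of [critical]. *)
Lemma parking_critical n (Delta : 'M[int]_n) (u chi : 'rV[int]_n) j :
  (dvec Delta - u) 0 j < inner chi (col j Delta)^T <->
  critical Delta (u + chi *m Delta) j.
Proof.
rewrite inner_col /critical [(u + _) 0 j]mxE [(_ - u) 0 j]mxE.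
by rewrite [dvec _ _ _]mxE [(- u) 0 j]mxE ltrBlDl ltrBlDr ltzD1.
Qed.

Lemma dvec_sub_ge0 n (Delta : 'M[int]_n) (u : 'rV[int]_n) i :
  0 <= (dvec Delta - u) 0 i <-> ~ critical Delta u i.
Proof.
by rewrite /critical !mxE subr_ge0 lerBrDr lezD1 ltNge; split=> /negP.
Qed.

(** The diagonal terms agree, and all other coefficients in column [i] are nonpositive, so larger
    entries there only lower the sum. *)
Lemma mulmx_offdiag_anti n (Delta : 'M[int]_n) (chi rho : 'rV[int]_n) i :
  (forall i j : 'I_n, i != j -> Delta i j <= 0) ->
  (forall k, chi 0 k <= rho 0 k) -> chi 0 i = rho 0 i ->
  (rho *m Delta) 0 i <= (chi *m Delta) 0 i.
Proof.
move=> hoff le_chi eq_i; rewrite !mxE; apply: ler_sum => k _.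
by have [->|ki] := eqVneq k i; [rewrite eq_i | apply: ler_wnM2r => //; apply: hoff].
Qed.

(** Starting from [u + score s *m Delta] means that [s] ends at [u], a form preserved when the first
    toppling is removed. *)
Lemma topplings_critical n (Delta : 'M[int]_n) (u chi : 'rV[int]_n) s :
  (forall i j : 'I_n, i != j -> Delta i j <= 0) ->
  topplings Delta (u + score s *m Delta) s ->
  (forall k, 0 <= chi 0 k <= score s 0 k) -> (exists k, chi 0 k != 0) ->
  exists j, 1 <= chi 0 j /\ critical Delta (u + chi *m Delta) j.
Proof.
move=> hoff; elim: s => [_ le_chi [k]|i s IHs [crit_i tops] le_chi chi_n0].
  by have := le_chi k; rewrite /score big_nil mxE -eq_le eq_sym => ->.
have [le_s|] := boolP [forall k, chi 0 k <= score s 0 k].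
  apply: IHs => // [|k]; last by have := le_chi k; have/forallP/(_ k) := le_s; lia.
  move: tops; rewrite /topple /score big_cons mulmxDl -rowE addrCA.
  by rewrite [row i Delta + _]addrC addrK.
case/forallPn => k; rewrite -ltNge => lt_k.
(* Removing [i] from the sequence lowers only coordinate [i] of the score, so domination can fail
   only there; this forces [chi 0 i] to equal [score (i :: s) 0 i]. *)
have k_i : k = i.
  apply/eqP; have := le_chi k; rewrite score_cons.
  by case: eqP => // _; lia.
subst k; have := le_chi i; rewrite score_cons eqxx => le_i.
have s_ge0 := score_ge0 _ s i; exists i; split; first by lia.
apply: (le_trans crit_i); rewrite !mxE lerD2l.
have := @mulmx_offdiag_anti _ Delta chi (score (i :: s)) i hoff; rewrite !mxE; apply.
  by move=> k; case/andP: (le_chi k).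
by rewrite score_cons eqxx; lia.
Qed.

Lemma parking_transforms n (Delta : 'M[int]_n) (r u chi : 'rV[int]_n) :
  parking Delta r (dvec Delta - u) -> (forall k, 0 <= chi 0 k <= r 0 k) ->
  transforms Delta (u + chi *m Delta) u.
Proof.
move=> [_ park]; have [m] := ubnP `|(\sum_k chi 0 k)%R|%N.
elim: m chi => // m IHm chi lt_m le_chi.
have [->|] := eqVneq chi 0.
  by exists [::]; split=> //; rewrite mul0mx big_nil addr0 subr0.
case/rV0Pn => k chi_k.
have [|j [chi_j /andP[_ /parking_critical crit_j]]] := park chi.
  by split=> //; exists k.
pose chi' := chi - delta_mx 0 j.
have chi'E l : chi' 0 l = chi 0 l - (l == j)%:R by rewrite !mxE eqxx.
have le_chi' l : 0 <= chi' 0 l <= r 0 l.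
  by rewrite chi'E; have := le_chi l; case: eqP => [->|_]; lia.
have sum_chi' : \sum_l chi' 0 l = \sum_l chi 0 l - 1.
  under eq_bigr do rewrite chi'E.
  by rewrite sumrB -natr_sum -big_mkcond /= big_pred1_eq.
(* The induction measure is an absolute value; it drops with the sum only because the new sum is
   still nonnegative. *)
have sum_ge0 : 0 <= \sum_l chi' 0 l.
  by apply: sumr_ge0 => l _; case/andP: (le_chi' l).
have topE : topple Delta (u + chi *m Delta) j = u + chi' *m Delta.
  by rewrite /topple mulmxBl -rowE addrA.
have [|s [tops sumE]] := IHm chi' _ le_chi'.
  rewrite sum_chi' in sum_ge0 *; move: lt_m sum_ge0.
  by move: (\sum_k chi 0 k) => x; lia.
exists (j :: s); split; first by rewrite /= topE.
by rewrite big_cons opprD addrA -/(topple _ _ _) topE.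
Qed.

Theorem lemma3p4 (n : nat) (hn : (1 <= n)%N) (Delta : 'M[int]_n)
  (hdet : \det Delta != 0)
  (hoff : forall i j : 'I_n, i != j -> Delta i j <= 0)
  (hex : exists r : 'rV[int]_n, vpos r /\ vge (r *m Delta) 0)
  (r : 'rV[int]_n) (hr : scriptR Delta r)
  (u : 'rV[int]_n) (hu : configuration u) :
  recurrent Delta r u <-> parking Delta r (dvec Delta - u).
Proof.
split=> [[[_ stab] [s [tops sumE]]]|park].
  have d_ge0 i : 0 <= (dvec Delta - u) 0 i by apply/dvec_sub_ge0.
  (* Comparing both ends of the sequence gives [r *m Delta = score s *m Delta]. *)
  have rE : r = score s.
    apply: (mulmx_det_inj _ _ _ _ hdet); apply/eqP; rewrite -subr_eq0.
    move/eqP: sumE; rewrite sum_rows_score -addrA eq_sym -subr_eq0.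
    by rewrite addrAC subrr add0r.
  split=> // chi [le_chi chi_n0].
  have [||j [chi_j crit_j]] := @topplings_critical _ Delta u chi s hoff _ _ chi_n0.
  - by rewrite -rE.
  - by move=> k; rewrite -rE.
  by exists j; split=> //; apply/andP; split=> //; apply/parking_critical.
split; first by split=> // i; apply/dvec_sub_ge0; case: park.
(* Here [chi] is [r] itself. *)
apply: (parking_transforms _ _ _ _ _ park) => k.
by rewrite lexx ltW //; case: hr => + _; apply.
Qed.
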